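(* For every probability distribution on $\mathbb R$ and every integer $b\ge 0$, the MedAD moment $\Phi_{b+1}$ exists and is finite.
   Context: For a real random variable $Y$, $\operatorname{Med}(Y)=\inf\{y:P(Y\le y)\ge 1/2\}$ denotes its median. Let $X$ be a real random variable with distribution function $F$ and quantile function $Q(p)=\inf\{x:F(x)\ge p\}$, $0<p<1$, and let $M=\operatorname{Med}(X)$. For an integer $b\ge2$ and $a=0,\dots,b-1$, the quantile slice $Q(a/b,(a+1)/b]$ is the block of the distribution corresponding to the levels $(a/b,(a+1)/b]$ of the distribution function, so the $b$ slices are equiprobable, each of mass $1/b$; formally, writing $X=Q(U)$ with $U$ uniform on $(0,1)$, the event $X\in Q(a/b,(a+1)/b]$ is $U\in(a/b,(a+1)/b]$ (for continuous $F$ this is, up to a null event, $Q(a/b)<X\le Q((a+1)/b)$, with $Q(0)=-\infty$, $Q(1)=+\infty$). The MedAD (median absolute deviation) moments are $$\Phi_1=M,\qquad \Phi_2=\operatorname{Med}|X-M|,\qquad \Phi_{b+1}=\sum_{a=0}^{b-1}(-1)^{a+1}\operatorname{Med}\big(|X-M|\,\mathbf I_{X\in Q(a/b,(a+1)/b]}\big)\quad(b\ge2),$$ where $\operatorname{Med}(|X-M|\,\mathbf I_{X\in Q(a/b,(a+1)/b]})$ means the median of $|X-M|$ within the slice, i.e. the median of the conditional distribution of $|X-M|$ given $X\in Q(a/b,(a+1)/b]$. *)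

(* Defs.v *)
From HB Require Import structures.
From mathcomp Require Import all_boot all_order all_algebra.
From mathcomp Require Import all_classical all_reals all_analysis.

Set Implicit Arguments.
Unset Strict Implicit.
Unset Printing Implicit Defensive.

Import Order.TTheory GRing.Theory Num.Theory.

Local Open Scope classical_set_scope.
Local Open Scope ring_scope.
Local Open Scope ereal_scope.

(* Everything below is computed in [\bar R], without any default real value:
   - the infimum of an empty set of reals is [+oo], that of a set unbounded
     below is [-oo];
   - if the center [M] were infinite, [`|x - M|] would be [+oo] for every real
     [x], hence so would its median;
   - if the conditioning event had mass 0, [cond_law] would vanish and the
     conditional median would be [+oo];
   - [+oo + -oo = -oo] in [\bar R], so that a finite sum is finite only if all
     its terms are.
   Hence a moment below is a real number only if its center, the conditional
   laws and all the medians entering its definition exist and are finite. *)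

Definition median (R : realType) (T : Type) (mu : set T -> \bar R)
    (Y : T -> \bar R) : \bar R :=
  ereal_inf [set y%:E | y in
    [set y : R | (2^-1)%:E <= mu [set t | Y t <= y%:E]]].

Definition cond_law (R : realType) (T : Type) (mu : set T -> \bar R)
    (B : set T) : set T -> \bar R :=
  fun A => mu (A `&` B) / mu B.

Section medad.
Context d (T : measurableType d) (R : realType) (P : probability T R).
Variable X : {RV P >-> R}.

Definition quantile (p : R) : \bar R :=
  ereal_inf [set x%:E | x in [set x : R | p%:E <= cdf X x]].

Definition center : \bar R := median P (fun t => (X t)%:E).

(* The range of levels defining the [a]-th slice, among [b]. *)
Definition slice_levels (b a : nat) : set R :=
  [set` `](a%:R / b%:R)%R, (a.+1%:R / b%:R)%R]].

(* [quantile] is composed with the canonical uniform variable, i.e. the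
   identity on [R] equipped with the uniform law; the levels [u] outside
   ]0, 1[ form a null set for that law. *)
Definition slice_median (b a : nat) : \bar R :=
  median (cond_law (uniform_prob (@ltr01 R)) (slice_levels b a))
         (fun u : R => `|quantile u - center|).

(* Indexed from 1; the value at 0 is irrelevant. *)
Definition medad_moment (n : nat) : \bar R :=
  match n with
  | 0 => 0
  | 1 => center
  | 2 => median P (fun t => `|(X t)%:E - center|)
  | b.+1 => \sum_(a < b) (((-1) ^+ a.+1)%R)%:E * slice_median b a
  end.

End medad.

(* Main.v *)
(* [center X] is the quantile of level 1/2, and a quantile of level in ]0, 1[ is
   finite because the distribution function goes from 0 to 1. As |X - M| is
   again a random variable, its median is finite too. For the slice
   ]a/b, (a+1)/b], even if it touches 0 or 1, the central half
   [(a + 1/4)/b, (a + 3/4)/b] has conditional mass 1/2 and lies in ]0, 1[;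
   there the quantile function, being monotone, is bounded by two finite
   quantiles, which bounds the conditional median from above; 0 bounds it from
   below. *)
Require Import Defs.
From HB Require Import structures.
From mathcomp Require Import all_boot all_order all_algebra.
From mathcomp Require Import all_classical all_reals all_analysis.
From mathcomp Require Import measurable_realfun ring lra.

Set Implicit Arguments.
Unset Strict Implicit.
Unset Printing Implicit Defensive.

Import Order.TTheory GRing.Theory Num.Theory.

Local Open Scope classical_set_scope.
Local Open Scope ring_scope.
Local Open Scope ereal_scope.

Lemma ereal_inf_EFin_fin_num (R : realType) (A : set R) :
  A !=set0 -> has_lbound A -> ereal_inf [set y%:E | y in A] \is a fin_num.
Proof. by move=> A0 lA; rewrite ereal_inf_EFin. Qed.

Lemma centerE d (T : measurableType d) (R : realType) (P : probability T R)
    (X : {RV P >-> R}) : Defs.center X = quantile X 2^-1.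
Proof. by []. Qed.

Lemma quantile_fin_num d (T : measurableType d) (R : realType)
    (P : probability T R) (X : {RV P >-> R}) (p : R) :
  (0 < p < 1)%R -> quantile X p \is a fin_num.
Proof.
move=> /andP[p0 p1]; apply: ereal_inf_EFin_fin_num.
  (* Nonemptiness: the limit 1 at [+oo] exceeds [p]. The eventual bound holds strictly beyond [M],
     hence the witness [M + 1]. *)
  have := cvg_cdfy1 X => /(_ [set y | p%:E < y])[].
    by apply: open_nbhs_nbhs; split;
      [exact: open_ereal_gt_ereal | rewrite /= lte_fin].
  by move=> M [_ /(_ (M + 1)%R)]; rewrite ltrDl ltr01 => /(_ isT) /ltW;
    exists (M + 1)%R.
(* Lower bound: the limit 0 at [-oo] is less than [p], so no point far to the left reaches level
   [p]. *)
have := cvg_cdfNy0 X => /(_ [set y | y < p%:E])[].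
  by apply: open_nbhs_nbhs; split;
    [exact: open_ereal_lt_ereal | rewrite /= lte_fin].
move=> M [_ cdfM]; exists (M - 1)%R => x /= px; rewrite leNgt; apply/negP => xM.
have /cdfM : (x < M)%R by lra.
by rewrite /= ltNge px.
Qed.

Lemma quantile_le d (T : measurableType d) (R : realType)
    (P : probability T R) (X : {RV P >-> R}) :
  {homo quantile X : p q / (p <= q)%R >-> p <= q}.
Proof.
move=> p q pq; apply: ereal_inf_le_tmp => _ [x /= qx <-].
by exists x => //=; rewrite (le_trans _ qx)// lee_fin.
Qed.

Lemma center_fin_num d (T : measurableType d) (R : realType)
    (P : probability T R) (X : {RV P >-> R}) : Defs.center X \is a fin_num.
Proof. by rewrite centerE quantile_fin_num// invr_gt0 ltr0n invf_lt1 ?ltr1n. Qed.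

Lemma median_absdev_fin_num d (T : measurableType d) (R : realType)
    (P : probability T R) (X : {RV P >-> R}) (c : R) :
  median P (fun t => `|(X t)%:E - c%:E|) \is a fin_num.
Proof.
have mY : measurable_fun setT (fun t => `|X t - c|%R).
  by apply: measurableT_comp => //; apply: measurable_funB.
pose Y : {RV P >-> R} := mfun_Sub (mem_set mY).
have -> : median P (fun t => `|(X t)%:E - c%:E|) = Defs.center Y by [].
exact: center_fin_num.
Qed.

(** The density is 1 throughout the interval. Endpoints are left free to cover both the half-open
    slices and their closed central halves. *)
Lemma uniform_prob01_itv (R : realType) (b0 b1 : bool) (p q : R) :
  (0 <= p)%R -> (p < q)%R -> (q <= 1)%R ->
  uniform_prob (@ltr01 R) [set` Interval (BSide b0 p) (BSide b1 q)] =
  (q - p)%:E.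
Proof.
move=> p0 pq q1; rewrite /uniform_prob (eq_integral (cst 1)).
  by rewrite integral_cst//= mul1e lebesgue_measure_itv/= lte_fin pq EFinB.
move=> x; rewrite inE /= in_itv => /andP[/lteifW px /lteifW xq].
by rewrite /uniform_pdf subr0 invr1 ifT// (le_trans p0 px) (le_trans xq q1).
Qed.

Lemma slice_median_fin_num d (T : measurableType d) (R : realType)
    (P : probability T R) (X : {RV P >-> R}) (b a : nat) :
  (a < b)%N -> slice_median X b a \is a fin_num.
Proof.
move=> ab; set U := uniform_prob (@ltr01 R); set B := @slice_levels R b a.
have b0 : (0 < b%:R :> R)%R by rewrite ltr0n (leq_trans _ ab).
have a0 : (0 <= a%:R :> R)%R by [].
have ab1 : (a%:R + 1 <= b%:R :> R)%R by rewrite natr1 ler_nat.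
have UB : U B = (b%:R^-1)%:E.
  rewrite /U /B /slice_levels uniform_prob01_itv.
  - by rewrite -mulrBl -natr1 addrAC subrr add0r mul1r.
  - by rewrite divr_ge0// ltW.
  - by rewrite ltr_pM2r ?invr_gt0// ltr_nat.
  - by rewrite ler_pdivrMr// mul1r ler_nat.
have cM := center_fin_num X.
apply: ereal_inf_EFin_fin_num; last first.
  (* For [y < 0] the event is empty, so its conditional mass cannot reach 1/2. *)
  exists 0%R => y /= hy; rewrite leNgt; apply/negP => y0.
  move: hy; rewrite /cond_law (_ : _ `&` _ = set0).
    by rewrite measure0 mul0e leNgt lte_fin invr_gt0 ltr0n.
  rewrite -subset0 => u [/= + _]; rewrite leNgt => /negP; apply.
  by rewrite (@lt_le_trans _ _ 0)// lte_fin.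
pose p : R := ((a%:R + 4^-1) / b%:R)%R; pose q : R := ((a%:R + 3 / 4) / b%:R)%R.
have p0 : (0 < p)%R by rewrite divr_gt0//; lra.
have pq : (p < q)%R by rewrite ltr_pM2r ?invr_gt0//; lra.
have q1 : (q < 1)%R by rewrite ltr_pdivrMr// mul1r; lra.
have qp : (q - p = 2^-1 / b%:R)%R by rewrite /q /p; field; lra.
have Qp : quantile X p \is a fin_num by rewrite quantile_fin_num// p0 (lt_trans pq).
have Qq : quantile X q \is a fin_num by rewrite quantile_fin_num// q1 (lt_trans p0).
pose m := fine (Defs.center X).
have mE : Defs.center X = m%:E by rewrite fineK.
pose s := fine (quantile X p); have sE : quantile X p = s%:E by rewrite fineK.
pose t := fine (quantile X q); have tE : quantile X q = t%:E by rewrite fineK.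
(* This sum dominates both [|s - m|] and [|t - m|], hence the distance from [m] to any point between
   [s] and [t]. *)
exists (`|s - m| + `|t - m|)%R => /=; set y := (_ + _)%R.
(* The slice has nonzero mass [1/b], so the goal becomes a lower bound [q - p] on the unconditional
   mass of [A]. *)
rewrite -/U -/B /cond_law UB inver gt_eqF ?invr_gt0//.
rewrite invrK -lee_pdivrMr//.
rewrite -EFinM -qp; set A := _ `&` _.
have AE u : `|quantile X u - Defs.center X| <= y%:E =
    ((m - y)%:E <= quantile X u <= (m + y)%:E).
  rewrite mE; case: (quantile X u) => [r| |].
  - by rewrite -EFinB abse_EFin !lee_fin ler_norml lerBrDr lerBlDr addrC
      [(y + m)%R]addrC.
  - by rewrite addye//= leNgt ltry leye_eq andbF.
  - by rewrite addNye//= leeNy_eq.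
(* The quantile function is monotone, so [A] is an interval, hence measurable. *)
have mA : measurable A.
  apply: is_interval_measurable => u v [].
  rewrite /= !AE => /andP[ulo _] uB [/=]; rewrite AE => /andP[_ vhi] vB w uwv.
  have /andP[uw wv] := uwv; split; last exact: interval_is_interval uB vB _ uwv.
  by rewrite /= AE (le_trans ulo) ?quantile_le// (le_trans _ vhi)// quantile_le.
(* Reading [q - p] as the mass of [[p, q]] leaves only the inclusion of [[p, q]] in [A]. *)
rewrite -(uniform_prob01_itv true false (ltW p0) pq (ltW q1)).
apply: le_measure; rewrite ?inE// => u /= /[!in_itv]/= /andP[pu uq]; split=> /=.
  rewrite AE; apply/andP; split.
  - rewrite (le_trans _ (quantile_le X pu))// sE lee_fin /y.
    have := lerNnormlW (lexx `|s - m|%R).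
    by have := normr_ge0 (t - m)%R; lra.
  - rewrite (le_trans (quantile_le X uq))// tE lee_fin /y.
    have := ler_norm (t - m)%R.
    by have := normr_ge0 (s - m)%R; lra.
rewrite /B /slice_levels/= in_itv/=; apply/andP; split.
- by rewrite (lt_le_trans _ pu)// ltr_pM2r ?invr_gt0//; lra.
- by rewrite (le_trans uq)// ler_pM2r ?invr_gt0// -natr1; lra.
Qed.

Theorem theorem6 (d : measure_display) (T : measurableType d) (R : realType)
    (P : probability T R) (X : {RV P >-> R}) (b : nat) :
  medad_moment X b.+1 \is a fin_num.
Proof.
have cM := center_fin_num X.
(* The alternating sum starts at two slices; the first two moments are single medians. *)
case: b => [//|[|b]] /=.
  by rewrite -(fineK cM) median_absdev_fin_num.
by apply/sum_fin_numP => a _ _; rewrite fin_numM// slice_median_fin_num.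
Qed.
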